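(* Let $n\ge 2$, let $m_1,\dots,m_n>0$, and let $a=(a_1,\dots,a_n)\in\mathbb{R}^{2n}$ be a non-degenerate central configuration in the plane. Then there is a constant $\kappa_0>0$ such that for all $\kappa\in\mathbb{R}$ with $|\kappa|<\kappa_0$, the equation $\nabla_u L(u;\kappa)=0$ has an $SO(2)$-orbit of solutions $\{e^{\mathcal{J}\theta}u(\kappa):\theta\in SO(2)\}$, where $$u(\kappa)=a+\mathcal{O}(\kappa)\in\mathbb{R}^{2n}\qquad(\kappa\to 0).$$
   Context: Write $u=(u_1,\dots,u_n)\in\mathbb{R}^{2n}$ with $u_j=(x_j,y_j)\in\mathbb{R}^2\simeq\mathbb{C}$, and let $\cdot$ be the Euclidean inner product. Positive masses $m_1,\dots,m_n$ are fixed. For $\kappa\in\mathbb{R}$ define $$V(u_j,u_k;\kappa)=\frac{4(u_j\cdot u_k)\kappa+(|u_k|^2\kappa-1)(|u_j|^2\kappa-1)}{2|u_j-u_k|\left(|u_k|^2|u_j|^2\kappa^2+2(u_j\cdot u_k)\kappa+1\right)^{1/2}},\qquad \lambda(u_j;\kappa)=\frac{4}{(1+\kappa|u_j|^2)^2},$$ and the Lagrangian for steady solutions in coordinates rotating with unit angular velocity $$L(u;\kappa)=\frac12\sum_{j=1}^n m_j\,\lambda(u_j;\kappa)|u_j|^2+\sum_{1\le j<k\le n}m_jm_k\,V(u_j,u_k;\kappa),$$ defined for collision-free $u$ (i.e. $u_j\ne u_k$ for $j\neq k$) at which the denominators do not vanish (for $u$ in a small neighbourhood of a given collision-free configuration this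 holds for all sufficiently small $|\kappa|$). It is (in stereographic coordinates) the Lagrangian of the $n$-body problem on the surface of constant curvature $\kappa$; for $\kappa=0$ it is the planar Newtonian one, with $$L(u;0)=\frac12\sum_j 4m_j|u_j|^2+\frac12\sum_{j<k}\frac{m_jm_k}{|u_j-u_k|}.$$ Let $J=\begin{pmatrix}0&-1\\1&0\end{pmatrix}$ and $\mathcal{J}=J\oplus\dots\oplus J$ ($n$ copies). The group $G=SO(2)$ acts on $\mathbb{R}^{2n}$ by $\theta\cdot u=e^{\mathcal{J}\theta}u$, and $L(\cdot;\kappa)$ is $G$-invariant. A central configuration is a collision-free $a=(a_1,\dots,a_n)\in\mathbb{R}^{2n}$ satisfying $$4a_j=\frac12\sum_{k\ne j}m_k\frac{a_j-a_k}{\|a_j-a_k\|^3},\qquad j=1,\dots,n$$ (equivalently, $\nabla_uL(a;0)=0$). It is called non-degenerate if the Hessian $D_u^2L(a;0)$ has only one zero eigenvalue (i.e. zero is a simple eigenvalue), with eigenvector $\mathcal{J}a$. *)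

(* Defs.v *)
From HB Require Import structures.
From mathcomp Require Import all_boot all_order all_algebra.
From mathcomp Require Import all_classical all_reals all_analysis.
Import Order.TTheory GRing.Theory Num.Theory.
Import numFieldNormedType.Exports.

Set Implicit Arguments.
Unset Strict Implicit.
Unset Printing Implicit Defensive.

Local Open Scope classical_set_scope.
Local Open Scope ring_scope.

Section Calculus.
Context {R : realType} {d : nat}.
Implicit Types (f : 'rV[R]_d -> R) (u v : 'rV[R]_d) (A : 'M[R]_d).

Definition gradient f u : 'rV[R]_d := \row_i 'D_(delta_mx 0 i) f u.

Definition hessian f u : 'M[R]_d :=
  \matrix_(i, j) 'D_(delta_mx 0 i) (fun v => 'D_(delta_mx 0 j) f v) u.

Definition expmx A : 'M[R]_d :=
  limn (series (fun k : nat => (k`!%:R)^-1 *: A ^+ k)).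

(* The vector A u; vectors are stored as rows but operators act on columns. *)
Definition mxapp A u : 'rV[R]_d := u *m A^T.

(* The library norm of a row vector is the sup norm, hence the explicit
   Euclidean one. *)
Definition dot u v : R := \sum_i u 0 i * v 0 i.
Definition enorm u : R := Num.sqrt (dot u u).

End Calculus.

(* R^{2n} as n concatenated blocks of size 2. *)
Definition config (R : realType) (n : nat) := 'rV[R]_(\sum_(j < n) 2).

Section CurvedNBody.
Context {R : realType} {n : nat} (m : 'I_n -> R).
Implicit Types (u v a : config R n) (kappa : R).

Definition body u (j : 'I_n) : 'rV[R]_2 := submxrow u j.

Definition collision_free u := forall j k : 'I_n, j != k -> body u j != body u k.

Definition conf_factor (p : 'rV[R]_2) kappa : R :=
  4 / (1 + kappa * enorm p ^+ 2) ^+ 2.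

Definition radicand (p q : 'rV[R]_2) kappa : R :=
  enorm q ^+ 2 * enorm p ^+ 2 * kappa ^+ 2 + 2 * dot p q * kappa + 1.

Definition potential (p q : 'rV[R]_2) kappa : R :=
  (4 * dot p q * kappa
     + (enorm q ^+ 2 * kappa - 1) * (enorm p ^+ 2 * kappa - 1))
  / (2 * enorm (p - q) * Num.sqrt (radicand p q kappa)).

Definition lagrangian kappa u : R :=
  2^-1 * (\sum_(j < n) m j * conf_factor (body u j) kappa * enorm (body u j) ^+ 2)
  + \sum_(j < n) \sum_(k < n | (j < k)%N)
      m j * m k * potential (body u j) (body u k) kappa.

(* The open set on which [lagrangian kappa] is a genuine smooth formula:
   no division by zero, and the square roots are taken of positive numbers. *)
Definition lagrangian_dom kappa u :=
  [/\ collision_free u,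
      (forall j, 1 + kappa * enorm (body u j) ^+ 2 != 0) &
      (forall j k : 'I_n, j != k -> 0 < radicand (body u j) (body u k) kappa)].

(* Library derivatives are total, so membership in the domain is required for
   the equation to be meaningful. *)
Definition critical_points kappa : set (config R n) :=
  [set u | lagrangian_dom kappa u /\ gradient (lagrangian kappa) u = 0].

Definition J2 : 'M[R]_2 := delta_mx 1 0 - delta_mx 0 1.

Definition calJ : 'M[R]_(\sum_(j < n) 2) := \mxdiag_(j < n) J2.

Definition SO2_orbit u : set (config R n) :=
  [set mxapp (expmx (theta *: calJ)) u | theta in [set: R]].

Definition central_configuration a :=
  collision_free a /\
  forall j : 'I_n, 4 *: body a j =
    2^-1 *: \sum_(k < n | k != j)
       (m k / enorm (body a j - body a k) ^+ 3) *: (body a j - body a k).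

(* Zero counted with algebraic multiplicity, i.e. as a root of the
   characteristic polynomial of the Hessian. *)
Definition nondegenerate_config a :=
  let H := hessian (lagrangian 0) a in
  [/\ mup 0 (char_poly H) = 1%N,
      mxapp calJ a != 0 &
      mxapp H (mxapp calJ a) = 0].

End CurvedNBody.

(* Main.v *)
Require Import Defs.
From HB Require Import structures.
From mathcomp Require Import all_boot all_order all_algebra.
From mathcomp Require Import all_classical all_reals all_analysis.
From mathcomp Require Import ring lra zify.
Import Order.TTheory GRing.Theory Num.Theory.
Import numFieldNormedType.Exports.
Set Implicit Arguments.
Unset Strict Implicit.
Unset Printing Implicit Defensive.
Local Open Scope classical_set_scope.
Local Open Scope ring_scope.

(** The solutions for small curvature are continued from the central
configuration [a] at curvature [0] by the implicit function theorem.  Rotations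
make this degenerate: with [J] the rotation by a right angle in every plane
factor, the Hessian [H] of the Lagrangian at [a] kills [w = J a].  The
degeneracy is removed by solving, instead of [grad L (u, kappa) = 0], the
bordered equation
  [grad L (u, kappa) + ((u - a) . w) w = 0].
Its derivative at [(a, 0)] is [H + w^T w].  Zero being a simple eigenvalue of
[H], and [w] being in its kernel on both sides, this matrix is invertible
([simple_eigenvalue_unitmx]), so the bordered equation has a solution
[u kappa = a + O(kappa)] ([implicit_function]).

A solution of the bordered equation is a true critical point.  As [L] is
constant along the rotations of [u], its gradient at [u] is orthogonal to [J u]
([gradient_orth]).  The product of the bordered equation with [J u] is thus
[((u - a) . w) (w . J u) = 0], and [w . J u] is close to [w . w > 0]; so the
border term vanishes, and the gradient with it.  Rotating [u kappa] gives the
whole orbit ([critical_points_rot]), because the exponential of [theta J] is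
[cos theta + sin theta J] ([expmx_complex_structure]).

The regularity needed is that the partial derivatives of [L] are strictly
differentiable at [(a, 0)], jointly in [u] and [kappa].  It comes from the
class [elementary]: functions built from continuous linear forms by sums,
products, inverses and square roots are strictly differentiable, with
directional derivatives in the same class ([elementary_derivative]), and the
Lagrangian is one of them ([elementary_lagrangian]).  Strict differentiability,
unlike mere differentiability, says that [f] minus its derivative has a small
Lipschitz constant near the point, which is what turns the implicit equation
into a fixed point problem for a contraction; it also makes the calculus rules
direct estimates, with no mean value theorem. *)

(** * Strict differentiability *)

Section Diagonal.
Context {T U : topologicalType}.
Implicit Types (g : T -> U) (x : T) (l : U).

Lemma cvg_fst_diag g x l :
  g z @[z --> x] --> l -> g p.1 @[p --> (x, x)] --> l.
Proof. by move=> cg; apply: (cvg_comp _ _ _ cg); exact: cvg_fst. Qed.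

Lemma cvg_snd_diag g x l :
  g z @[z --> x] --> l -> g p.2 @[p --> (x, x)] --> l.
Proof. by move=> cg; apply: (cvg_comp _ _ _ cg); exact: cvg_snd. Qed.

Lemma cvg_diag g x l :
  g z @[z --> x] --> l -> (g p.1, g p.2) @[p --> (x, x)] --> (l, l).
Proof.
move=> cg; apply: (@cvg_pair _ _ _ (nbhs (x, x)) (nbhs l) (nbhs l)).
- exact: cvg_fst_diag.
- exact: cvg_snd_diag.
Qed.

Lemma near_fst_diag x (P : T -> Prop) :
  (\forall z \near x, P z) -> \forall p \near (x, x), P p.1.
Proof. by move=> nP; apply: cvg_fst. Qed.

Lemma near_snd_diag x (P : T -> Prop) :
  (\forall z \near x, P z) -> \forall p \near (x, x), P p.2.
Proof. by move=> nP; apply: cvg_snd. Qed.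

End Diagonal.

Section Strict.
Context {R : realType} {V : normedModType R}.
Implicit Types (f g h l : V -> R) (x v z : V).

(** Continuous linear forms, as a predicate on bare functions, so that the
derivative of a compound expression can be written as a plain formula. *)
Definition bounded_form l :=
  (forall c u v, l (c *: u + v) = c * l u + l v) /\
  exists2 C : R, 0 <= C & forall v, `|l v| <= C * `|v|.

(** Both points of the difference move, unlike in an ordinary derivative. *)
Definition strict_derivative f x l :=
  bounded_form l /\
  forall e : R, 0 < e -> \forall p \near (x, x),
    `|f p.1 - f p.2 - l (p.1 - p.2)| <= e * `|p.1 - p.2|.

Lemma bounded_formZ l c v : bounded_form l -> l (c *: v) = c * l v.
Proof.
move=> [lin _]; have l0 : l 0 = 0.
  have := lin 1 0 0; rewrite scaler0 addr0 mul1r => /eqP.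
  by rewrite eq_sym -subr_eq0 addrK => /eqP.
by rewrite -[c *: v]addr0 lin l0 addr0.
Qed.

Lemma bounded_formD l u v : bounded_form l -> l (u + v) = l u + l v.
Proof. by move=> [lin _]; rewrite -[u]scale1r lin mul1r scale1r. Qed.

Lemma bounded_form_comb l1 l2 (a b : R) : bounded_form l1 -> bounded_form l2 ->
  bounded_form (fun v => a * l1 v + b * l2 v).
Proof.
move=> [lin1 [C1 C10 b1]] [lin2 [C2 C20 b2]]; split.
  by move=> c u v; rewrite lin1 lin2; ring.
exists (`|a| * C1 + `|b| * C2); first by rewrite addr_ge0 ?mulr_ge0.
move=> v; rewrite (le_trans (ler_normD _ _))// !normrM mulrDl -!mulrA.
by rewrite lerD// ler_wpM2l.
Qed.

(** The common source of all the calculus rules below: the increments of sums,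
products, inverses and square roots are combinations of the increments of
their arguments, with coefficients that have a limit on the diagonal. *)
Lemma strict_derivative_comb f g h x lf lg (al be : V * V -> R) (al0 be0 : R) :
  strict_derivative f x lf -> strict_derivative g x lg ->
  al p @[p --> (x, x)] --> al0 -> be p @[p --> (x, x)] --> be0 ->
  (\forall p \near (x, x), h p.1 - h p.2 =
     al p * (f p.1 - f p.2) + be p * (g p.1 - g p.2)) ->
  strict_derivative h x (fun v => al0 * lf v + be0 * lg v).
Proof.
move=> [blf sf] [blg sg] cal cbe hE; split; first exact: bounded_form_comb.
have [[_ [Cf Cf0 bf]] [_ [Cg Cg0 bg]]] := (blf, blg) => e e0.
(* The constants that the estimate [part] below produces for the two terms. *)
pose K := (`|al0| + 1 + Cf) + (`|be0| + 1 + Cg).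
have K0 : 0 < K.
  by have := normr_ge0 al0; have := normr_ge0 be0; rewrite /K; lra.
pose d := e / K; have d0 : 0 < d by rewrite divr_gt0.
have nal := cvgr_dist_le _ _ cal _ d0; have nbe := cvgr_dist_le _ _ cbe _ d0.
have nal1 := cvgr_dist_le _ _ cal _ ltr01.
have nbe1 := cvgr_dist_le _ _ cbe _ ltr01.
near=> p.
have -> : h p.1 - h p.2 = al p * (f p.1 - f p.2) + be p * (g p.1 - g p.2).
  by near: p.
set N := `|p.1 - p.2|.
have part (k k0 D L C : R) : `|k0 - k| <= d -> `|k0 - k| <= 1 ->
    `|D - L| <= d * N -> `|L| <= C * N ->
    `|k * D - k0 * L| <= d * (`|k0| + 1 + C) * N.
  move=> kd k1 DL LC.
  have -> : k * D - k0 * L = k * (D - L) - (k0 - k) * L by ring.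
  rewrite (le_trans (ler_normB _ _))// !normrM.
  have -> : d * (`|k0| + 1 + C) * N =
    (`|k0| + 1) * (d * N) + d * (C * N) by ring.
  apply: lerD; apply: ler_pM => //.
  by rewrite -[k](subKr k0) (le_trans (ler_normB _ _))// lerD2l.
have -> : al p * (f p.1 - f p.2) + be p * (g p.1 - g p.2) -
    (al0 * lf (p.1 - p.2) + be0 * lg (p.1 - p.2)) =
    (al p * (f p.1 - f p.2) - al0 * lf (p.1 - p.2)) +
    (be p * (g p.1 - g p.2) - be0 * lg (p.1 - p.2)) by ring.
have -> : e = d * K by rewrite /d mulfVK// gt_eqF.
rewrite (le_trans (ler_normD _ _))// [d * K]mulrDr mulrDl.
apply: lerD; apply: part.
- near: p; exact: nal.
- near: p; exact: nal1.
- rewrite /N; near: p; exact: sf.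
- exact: bf.
- near: p; exact: nbe.
- near: p; exact: nbe1.
- rewrite /N; near: p; exact: sg.
- exact: bg.
Unshelve. all: by end_near. Qed.

Lemma strict_derivative_continuous f x l : strict_derivative f x l ->
  f z @[z --> x] --> f x.
Proof.
move=> [[_ [C C0 bl]] /(_ 1 ltr01) sf].
have C1 : 0 < C + 1 by lra.
apply/cvgrPdist_le => e e0.
have xx : (fun z => (z, x)) @ x --> (x, x).
  by apply: cvg_pair => //; exact: cvg_cst.
have nx := xx _ sf.
have nd : \forall z \near x, `|x - z| <= e / (C + 1).
  by apply: cvgr_dist_le; [exact: cvg_id|rewrite divr_gt0].
near=> z.
have s1 : `|f z - f x - l (z - x)| <= 1 * `|z - x| by near: z; exact: nx.
have s2 := bl (z - x).
have : `|x - z| <= e / (C + 1) by near: z.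
rewrite distrC ler_pdivlMr// => s3.
rewrite distrC -[f z - f x](subrK (l (z - x))) (le_trans (ler_normD _ _))//.
by move: s1 s2 s3; set N := `|z - x|; lra.
Unshelve. all: by end_near. Qed.

Lemma strict_derivative_derive f x l v : strict_derivative f x l ->
  'D_v f x = l v.
Proof.
move=> [bl sf]; apply: cvg_lim => //.
apply/cvgrPdist_le => e e0.
have v1 : 0 < `|v| + 1 by rewrite ltr_wpDl.
have e1 : 0 < e / (`|v| + 1) by rewrite divr_gt0.
have xx : (fun t : R => (t *: v + x, x)) @ (0:R) --> (x, x).
  apply: cvg_pair => /=; last exact: cvg_cst.
  have : t *: v + x @[t --> (0 : R)] --> 0 *: v + x.
    apply: cvgD; last exact: cvg_cst.
    by apply: cvgZ; [exact: cvg_id|exact: cvg_cst].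
  by rewrite scale0r add0r.
have nx := xx _ (sf _ e1).
near=> t.
have t0 : t != 0 by near: t; exact: nbhs_dnbhs_neq.
have H : `|f (t *: v + x) - f x - l (t *: v + x - x)| <=
    e / (`|v| + 1) * `|t *: v + x - x| by near: t; exact: nbhs_dnbhs nx.
move: H; rewrite addrK => H /=.
rewrite -(@ler_pM2l _ `|t|) ?normr_gt0// -normrM mulrBr.
rewrite -bounded_formZ// -[_ *: (_ - _)]/(_ * _) mulVKf// distrC.
rewrite (le_trans H)// normrZ mulrCA ler_pM2l ?normr_gt0//.
by rewrite mulrAC ler_pdivrMr// ler_pM2l// lerDl.
Unshelve. all: by end_near. Qed.

Lemma strict_derivative_eq f x l l' : l =1 l' ->
  strict_derivative f x l -> strict_derivative f x l'.
Proof. by move=> /funext ->. Qed.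

Lemma bounded_form_strict l x : bounded_form l -> strict_derivative l x l.
Proof.
move=> bl; split => // e e0; apply: (@nearW _ (nbhs (x, x))) => p.
have -> : l p.1 - l p.2 = l (p.1 - p.2).
  by rewrite bounded_formD// -[- p.2]scaleN1r bounded_formZ// mulN1r.
by rewrite subrr normr0 mulr_ge0// ltW.
Qed.

Lemma bounded_form0 : bounded_form (fun _ : V => 0).
Proof.
split=> [c u v|]; first by rewrite mulr0 addr0.
by exists 0 => // v; rewrite normr0 mul0r.
Qed.

Lemma strict_derivative_cst (c : R) x : strict_derivative (fun=> c) x (fun=> 0).
Proof.
split; first exact: bounded_form0.
move=> e e0; apply: (@nearW _ (nbhs (x, x))) => p; rewrite subrr subr0 normr0.
by rewrite mulr_ge0// ltW.
Qed.

Lemma strict_derivativeD f g x lf lg :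
  strict_derivative f x lf -> strict_derivative g x lg ->
  strict_derivative (fun z => f z + g z) x (fun v => lf v + lg v).
Proof.
move=> sf sg; apply: strict_derivative_eq; last first.
- apply: (strict_derivative_comb (al := fun=> 1) (be := fun=> 1) sf sg).
  + exact: cvg_cst.
  + exact: cvg_cst.
  + by apply: (@nearW _ (nbhs (x, x))) => p; ring.
- by move=> v /=; rewrite !mul1r.
Qed.

Lemma strict_derivativeM f g x lf lg :
  strict_derivative f x lf -> strict_derivative g x lg ->
  strict_derivative (fun z => f z * g z) x (fun v => g x * lf v + f x * lg v).
Proof.
move=> sf sg.
apply: (strict_derivative_comb (al := fun p => g p.2) (be := fun p => f p.1)
  sf sg).
- exact: (cvg_snd_diag (strict_derivative_continuous sg)).
- exact: (cvg_fst_diag (strict_derivative_continuous sf)).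
- by apply: (@nearW _ (nbhs (x, x))) => p; ring.
Qed.

Lemma strict_derivative_sum (I : Type) (r : seq I)
    (P : pred I) (F l : I -> V -> R) x :
  (forall i, P i -> strict_derivative (F i) x (l i)) ->
  strict_derivative (fun z => \sum_(i <- r | P i) F i z) x
    (fun v => \sum_(i <- r | P i) l i v).
Proof.
move=> sF; elim: r => [|i r ih].
  have E (G : I -> V -> R) : (fun z => \sum_(j <- [::] | P j) G j z) = fun=> 0.
    by apply/funext => z; rewrite big_nil.
  by rewrite !E; exact: strict_derivative_cst.
have E (G : I -> V -> R) : (fun z => \sum_(j <- i :: r | P j) G j z) =
    fun z => (if P i then G i z else 0) + \sum_(j <- r | P j) G j z.
  by apply/funext => z; rewrite big_cons; case: ifP; rewrite ?add0r.
rewrite !E; apply: strict_derivativeD => //; case Pi: (P i); first exact: sF.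
exact: strict_derivative_cst.
Qed.

Lemma strict_derivativeZ c f x l :
  strict_derivative f x l ->
  strict_derivative (fun z => c * f z) x (fun v => c * l v).
Proof.
move=> sf.
apply: strict_derivative_eq (strict_derivativeM (strict_derivative_cst c x) sf).
by move=> v /=; rewrite mulr0 add0r.
Qed.

(** A chain rule whose hypothesis on [phi] is a difference quotient [q]
continuous on the diagonal: for the inverse and the square root, [q] is an
explicit algebraic function. *)
Lemma strict_derivative_comp (phi : R -> R) (q : R * R -> R) f x l :
  strict_derivative f x l ->
  q st @[st --> (f x, f x)] --> q (f x, f x) ->
  (\forall st \near (f x, f x), phi st.1 - phi st.2 = q st * (st.1 - st.2)) ->
  strict_derivative (fun z => phi (f z)) x (fun v => q (f x, f x) * l v).
Proof.
move=> sf cq hq.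
have cf := strict_derivative_continuous sf.
have cff := cvg_diag cf.
apply: strict_derivative_eq; last first.
- apply: (strict_derivative_comb (al := fun p => q (f p.1, f p.2))
    (be := fun=> 0) sf sf).
  + exact: (cvg_comp _ _ cff cq).
  + exact: cvg_cst.
  + have := cff _ hq; apply: (@filterS _ (nbhs (x, x))) => p /= ->; ring.
- by move=> v /=; rewrite mul0r addr0.
Qed.

Lemma strict_derivativeV f x l : f x != 0 -> strict_derivative f x l ->
  strict_derivative (fun z => (f z)^-1) x
    (fun v => - ((f x)^-1 * (f x)^-1) * l v).
Proof.
move=> fx0 sf.
apply: (strict_derivative_comp (phi := GRing.inv)
  (q := fun st => - (st.1^-1 * st.2^-1)) sf).
  have cV : z^-1 @[z --> f x] --> (f x)^-1.
    by apply: (@cvgV _ _ (nbhs (f x)) _ id) => //; exact: cvg_id.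
  apply: (@cvgN _ _ _ (nbhs (f x, f x))).
  by apply: (@cvgM _ _ (nbhs (f x, f x)));
    [exact: cvg_fst_diag|exact: cvg_snd_diag].
have n0 : \forall s \near f x, s != 0.
  apply: (@cvgr_neq0 _ _ _ (nbhs (f x)) _ id (f x)) => //; exact: cvg_id.
near=> st.
have s0 : st.1 != 0 by near: st; exact: near_fst_diag n0.
have t0 : st.2 != 0 by near: st; exact: near_snd_diag n0.
by field; rewrite s0 t0.
Unshelve. all: by end_near. Qed.

Lemma strict_derivative_sqrt f x l : 0 < f x -> strict_derivative f x l ->
  strict_derivative (fun z => Num.sqrt (f z)) x
    (fun v => (2 * Num.sqrt (f x))^-1 * l v).
Proof.
move=> fx0 sf.
have r0 : 0 < Num.sqrt (f x) by rewrite sqrtr_gt0.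
have -> : (2 * Num.sqrt (f x))^-1 = (Num.sqrt (f x) + Num.sqrt (f x))^-1.
  by congr (_^-1); ring.
apply: (strict_derivative_comp (phi := Num.sqrt)
  (q := fun st => (Num.sqrt st.1 + Num.sqrt st.2)^-1) sf).
  have cs := @sqrt_continuous R (f x).
  apply: cvgV; first by rewrite gt_eqF// addr_gt0.
  by apply: cvgD; [exact: (cvg_fst_diag cs)|exact: (cvg_snd_diag cs)].
have n0 : \forall s \near f x, 0 < s.
  by apply: (@cvgr_gt _ _ (nbhs (f x)) _ id (f x)) => //; exact: cvg_id.
near=> st.
have s0 : 0 < st.1 by near: st; exact: near_fst_diag n0.
have t0 : 0 < st.2 by near: st; exact: near_snd_diag n0.
have d0 : 0 < Num.sqrt st.1 + Num.sqrt st.2 by rewrite addr_gt0 ?sqrtr_gt0.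
have -> : st.1 - st.2 = (Num.sqrt st.1 - Num.sqrt st.2) *
    (Num.sqrt st.1 + Num.sqrt st.2).
  by rewrite -subr_sqr !sqr_sqrtr ?ltW.
by rewrite mulrCA mulVf ?mulr1// gt_eqF.
Unshelve. all: by end_near. Qed.

(** Invariance under rotations, infinitesimally.  When [w = J x] with
[J^2 = -1], the curve is the rational parametrization of the orbit of [x] under
rotations, [t] being the tangent of the half angle ([rot_cayley] below).  The
increment of [f] along it vanishes, hence so does that of [l] up to an
arbitrarily small relative error; division by [2 t / (1 + t^2)] bounds
[l (w - t x)], and [t] tends to [0]. *)
Lemma strict_derivative_invariant f x w l :
  strict_derivative f x l ->
  (forall t : R, f (x + (2 * t / (1 + t ^+ 2)) *: (w - t *: x)) = f x) ->
  l w = 0.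
Proof.
move=> [bl sf] inv.
pose s (t : R) := 2 * t / (1 + t ^+ 2).
pose K : R := `|l x| + `|w| + `|x|.
have K0 : 0 <= K by rewrite !addr_ge0.
have cs : s t @[t --> (0 : R)] --> (0 : R).
  have : s t @[t --> (0 : R)] --> 2 * (0 : R) / (1 + 0 ^+ 2).
    apply: cvgM; first by apply: cvgM; [exact: cvg_cst|exact: cvg_id].
    apply: cvgV; first by rewrite expr0n addr0 oner_neq0.
    apply: cvgD; first exact: cvg_cst.
    by apply: cvgM; exact: cvg_id.
  by rewrite mulr0 mul0r.
have cx : (fun t : R => (x + s t *: (w - t *: x), x)) t @[t --> (0 : R)]
    --> (x, x).
  apply: cvg_pair => /=; last exact: cvg_cst.
  have : x + s t *: (w - t *: x) @[t --> (0 : R)] --> x + 0 *: (w - 0 *: x).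
    apply: cvgD; first exact: cvg_cst.
    apply: cvgZ => //; apply: cvgB; first exact: cvg_cst.
    by apply: cvgZ; [exact: cvg_id|exact: cvg_cst].
  by rewrite scale0r addr0.
have key (e : R) : 0 < e -> e <= 1 -> `|l w| <= e * K.
  move=> e0 e1.
  near (dnbhs (0 : R)) => t.
  have t0 : t != 0 by near: t; exact: nbhs_dnbhs_neq.
  have te : `|t| <= e.
    near: t; exact: (@dnbhs0_le R R).
  have : `|f (x + s t *: (w - t *: x)) - f x - l (x + s t *: (w - t *: x) - x)|
      <= e * `|x + s t *: (w - t *: x) - x|.
    near: t; apply: nbhs_dnbhs; exact: (cx _ (sf _ e0)).
  have st0 : 0 < `|s t|.
    rewrite normr_gt0 mulf_neq0 ?mulf_neq0 ?invr_neq0//.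
    by rewrite gt_eqF// ltr_wpDr// sqr_ge0.
  rewrite inv subrr sub0r normrN [x + _]addrC addrK bounded_formZ//.
  rewrite (normrM (s t)) (normrZ (s t)) mulrCA ler_pM2l// -scaleNr addrC => H.
  have lw : l w = l (- t *: x + w) + t * l x.
    by rewrite bounded_formD// bounded_formZ//; ring.
  have nw : `|- t *: x + w| <= `|x| + `|w|.
    rewrite (le_trans (ler_normD _ _))// lerD2r normrZ normrN.
    by rewrite ler_piMl// (le_trans te).
  rewrite lw (le_trans (ler_normD _ _))// normrM.
  have h1 : e * `|- t *: x + w| <= e * (`|x| + `|w|) by rewrite ler_wpM2l// ltW.
  have h2 : `|t| * `|l x| <= e * `|l x| by rewrite ler_wpM2r.
  have -> : e * K = e * (`|x| + `|w|) + e * `|l x| by rewrite /K; ring.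
  by rewrite lerD// (le_trans H).
apply/eqP; rewrite -normr_le0; apply/ler_addgt0Pr => e e0; rewrite add0r.
have K1 : 0 < K + 1 by lra.
have d0 : 0 < e / (K + 1) by rewrite divr_gt0.
have m1 : Num.min 1 (e / (K + 1)) <= 1 by rewrite ge_min lexx.
have m0 : 0 < Num.min 1 (e / (K + 1)) by rewrite lt_min ltr01.
rewrite (le_trans (key _ m0 m1))//.
apply: (@le_trans _ _ (e / (K + 1) * (K + 1))).
  apply: ler_pM => //; [exact: ltW| |by rewrite lerDl].
  by rewrite ge_min lexx orbT.
by rewrite mulfVK// gt_eqF.
Unshelve. all: by end_near. Qed.

End Strict.

Section Slice.
Context {R : realType} {U : normedModType R}.

Lemma strict_derivative_slice (f : U * R -> R) u k l :
  strict_derivative f (u, k) l ->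
  strict_derivative (fun v => f (v, k)) u (fun v => l (v, 0)).
Proof.
have E (v w : U) (h : R) : (v, h) - (w, h) = (v - w, 0).
  by congr (_, _); rewrite subrr.
have N (v : U) : `|(v, 0 : R)| = `|v| by rewrite prod_normE/= normr0 max_l.
move=> [[lin [C C0 bl]] sf]; split; first split.
- move=> c v w; rewrite -lin; congr (l (_, _)).
  by rewrite /= scaler0 addr0.
- by exists C => // v; rewrite -N.
- move=> e e0; have cu : ((fun v : U => (v, k)) v) @[v --> u] --> (u, k).
    by apply: (@cvg_pair _ _ _ (nbhs u) (nbhs u) (nbhs k));
      [exact: cvg_id|exact: cvg_cst].
  have := cvg_diag cu (sf e e0).
  by apply: (@filterS _ (nbhs (u, u))) => p /=; rewrite E N.
Qed.

Lemma bounded_form_fst (l : U -> R) :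
  bounded_form l -> bounded_form (fun z : U * R => l z.1).
Proof.
move=> [lin [C C0 bl]]; split=> [c u v|]; first exact: lin.
exists C => // z; rewrite (le_trans (bl _))// ler_wpM2l// prod_normE.
by rewrite le_max lexx.
Qed.

Lemma bounded_form_row d (l : 'rV[R]_d -> R) v : bounded_form l ->
  l v = \sum_i v 0 i * l (delta_mx 0 i).
Proof.
move=> bl; rewrite [v in LHS]row_sum_delta.
have l0 : l 0 = 0 by rewrite -[0](scale0r 0) bounded_formZ// mul0r.
rewrite (big_morph l (fun x y => bounded_formD x y bl) l0).
by apply: eq_bigr => i _; rewrite bounded_formZ.
Qed.

End Slice.

Lemma gradientE (R : realType) d (f : 'rV[R]_d -> R) u l :
  strict_derivative f u l ->
  gradient f u = \row_i l (delta_mx 0 i).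
Proof.
by move=> sf; apply/rowP => i; rewrite !mxE; exact: strict_derivative_derive.
Qed.

(** * A class of functions closed under differentiation *)

Section Elementary.
Context {R : realType} {V : normedModType R}.
Implicit Types (f g l : V -> R) (x v : V).

(** The domain [D] only carries the side conditions of inverses and square
roots; it does not change along a construction, so a function and all its
derivatives are regular on the same set. *)
Inductive elementary (D : set V) : (V -> R) -> Prop :=
| elementary_cst c : elementary D (fun=> c)
| elementary_form l of bounded_form l : elementary D l
| elementaryD f g of elementary D f & elementary D g :
    elementary D (fun x => f x + g x)
| elementaryM f g of elementary D f & elementary D g :
    elementary D (fun x => f x * g x)
| elementaryV f of elementary D f & (forall x, D x -> f x != 0) :
    elementary D (fun x => (f x)^-1)
| elementary_sqrt f of elementary D f & (forall x, D x -> 0 < f x) :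
    elementary D (fun x => Num.sqrt (f x)).

(** The derivative is again elementary, so the lemma can be applied to it: it
gives strict differentiability of all orders. *)
Lemma elementary_derivative D f : elementary D f ->
  exists df : V -> V -> R, (forall v, elementary D (df v)) /\
    forall x, D x -> strict_derivative f x (df^~ x).
Proof.
elim=> {f} [c|l bl|f g _ [df [ef sf]] _ [dg [eg sg]]
  |f g Ef [df [ef sf]] Eg [dg [eg sg]]
  |f Ef [df [ef sf]] f0|f Ef [df [ef sf]] f0].
- exists (fun _ _ => 0); split=> [v|x _]; first exact: elementary_cst.
  exact: strict_derivative_cst.
- exists (fun v _ => l v); split=> [v|x _]; first exact: elementary_cst.
  exact: bounded_form_strict.
- exists (fun v x => df v x + dg v x); split=> [v|x Dx].
    exact: elementaryD.
  by apply: strict_derivativeD; [exact: sf|exact: sg].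
- exists (fun v x => g x * df v x + f x * dg v x); split=> [v|x Dx].
    by apply: elementaryD; exact: elementaryM.
  by apply: strict_derivativeM; [exact: sf|exact: sg].
- exists (fun v x => -1 * ((f x)^-1 * (f x)^-1) * df v x); split=> [v|x Dx].
    apply: elementaryM => //; apply: elementaryM; first exact: elementary_cst.
    by apply: elementaryM; exact: elementaryV.
  apply: strict_derivative_eq (strict_derivativeV (f0 _ Dx) (sf _ Dx)) => v.
  by rewrite mulN1r.
- exists (fun v x => (2 * Num.sqrt (f x))^-1 * df v x); split=> [v|x Dx].
    apply: elementaryM => //; apply: elementaryV.
      by apply: elementaryM; [exact: elementary_cst|exact: elementary_sqrt].
    by move=> x Dx; rewrite mulf_neq0 ?pnatr_eq0// gt_eqF// sqrtr_gt0 f0.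
  by apply: strict_derivative_sqrt; [exact: f0|exact: sf].
Qed.

Lemma elementary_continuous D f x : elementary D f -> D x ->
  f y @[y --> x] --> f x.
Proof.
move=> /elementary_derivative[df [_ sf]] Dx.
exact: strict_derivative_continuous (sf _ Dx).
Qed.

Lemma elementary_ext D f g : f =1 g -> elementary D f -> elementary D g.
Proof. by move=> /funext ->. Qed.

Lemma elementaryN D f : elementary D f -> elementary D (fun x => - f x).
Proof.
move=> Ef; apply: (@elementary_ext _ (fun x => -1 * f x)) => [x|].
  by rewrite mulN1r.
by apply: elementaryM => //; exact: elementary_cst.
Qed.

Lemma elementary_sum D (I : Type) (r : seq I) (P : pred I) (F : I -> V -> R) :
  (forall i, P i -> elementary D (F i)) ->
  elementary D (fun x => \sum_(i <- r | P i) F i x).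
Proof.
move=> EF; elim: r => [|i r ih].
  suff -> : (fun x => \sum_(j <- [::] | P j) F j x) = fun=> 0.
    exact: elementary_cst.
  by apply/funext => x; rewrite big_nil.
have -> : (fun x => \sum_(j <- i :: r | P j) F j x) =
    fun x => (if P i then F i x else 0) + \sum_(j <- r | P j) F j x.
  by apply/funext => x; rewrite big_cons; case: ifP; rewrite ?add0r.
apply: elementaryD => //; case Pi: (P i); last exact: elementary_cst.
exact: EF.
Qed.

End Elementary.

(** * Simple eigenvalues *)

Lemma mulmx_tr_neq0 (F : realFieldType) d (w : 'rV[F]_d) :
  w != 0 -> w *m w^T != 0.
Proof.
apply: contraNneq => /(congr1 (fun A : 'M[F]_1 => A 0 0)).
rewrite !mxE => /eqP; rewrite psumr_eq0; last first.
  by move=> i _; rewrite mxE -expr2 sqr_ge0.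
move=> /allP w0; apply/eqP/rowP => i; rewrite [RHS]mxE.
by have := w0 i (mem_index_enum i); rewrite mxE -expr2 sqrf_eq0 => /eqP.
Qed.

Section Multiplicity.
Variable F : fieldType.

Lemma mulmx11_eq0 (x y : 'M[F]_1) : y != 0 -> x *m y = 0 -> x = 0.
Proof.
move=> y0 xy; have yu : y \in unitmx.
  rewrite unitmxE unitfE det_mx11; apply: contraNneq y0 => y00.
  by rewrite [y]mx11_scalar y00 raddf0.
by rewrite -[x](mulmxK yu) xy mul0mx.
Qed.

(** The geometric multiplicity of the eigenvalue [0] bounds the algebraic one
from below.  If [P] is invertible and [P A] has zero rows from the rank [r] of
[A] on, then the rows of [P ('X - A)] from [r] on are ['X] times those of [P];
taking this factor out of each of them shows that ['X^(d - r)] divides the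
characteristic polynomial. *)
Lemma corank_le_mup_char_poly d (A : 'M[F]_d) :
  (d - \rank A <= mup 0 (char_poly A))%N.
Proof.
set r := \rank A; pose P := invmx (col_ebase A).
have Pu : P \in unitmx by rewrite unitmx_inv col_ebase_unit.
pose P' : 'M[{poly F}]_d := map_mx polyC P.
have PA (i j : 'I_d) : (r <= i)%N -> (P *m A) i j = 0.
  move=> ri; rewrite -(mulmx_ebase A) -mulmxA mulKmx ?col_ebase_unit// mxE.
  by rewrite big1// => k _; rewrite mxE ltnNge ri andbF mul0r.
pose D : 'rV[{poly F}]_d := \row_i (if (i < r)%N then 1 else 'X).
pose B : 'M[{poly F}]_d :=
  \matrix_(i, j) if (i < r)%N then (P' *m char_poly_mx A) i j else P' i j.
have PB : P' *m char_poly_mx A = diag_mx D *m B.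
  have CE : P' *m char_poly_mx A = 'X *: P' - map_mx polyC (P *m A).
    by rewrite /char_poly_mx mulmxBr mul_mx_scalar map_mxM.
  apply/matrixP => i j; rewrite mul_diag_mx [RHS]mxE [D _ _]mxE [B i j]mxE.
  case: ltnP => ri; first by rewrite mul1r.
  by rewrite CE [LHS]mxE [X in _ + X]mxE [X in _ - X]mxE PA// subr0 mxE.
have dP : \det P' = (\det P)%:P by rewrite det_map_mx.
have dP0 : \det P != 0 by rewrite -unitfE -unitmxE.
have cE : \det P *: char_poly A = (\prod_i D 0 i) * \det B.
  by rewrite -det_diag -det_mulmx -PB det_mulmx dP mul_polyC.
have c0 : char_poly A != 0 by rewrite -size_poly_gt0 size_char_poly.
rewrite mup_geq// subr0 -(dvdpZr _ _ dP0) cE dvdp_mulr//.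
have -> : \prod_i D 0 i = 'X^(d - r); last exact: dvdpp.
have rd : (r <= d)%N by exact: rank_leq_row.
rewrite (eq_bigr (fun i : 'I_d => if (i < r)%N then 1 else 'X)); last first.
  by move=> i _; rewrite mxE.
rewrite -(big_mkord predT (fun i => if (i < r)%N then 1 else 'X)).
rewrite (big_cat_nat (n := r))//= big_nat_cond big1 ?mul1r; last first.
  by move=> i /andP[/andP[_ ->]].
rewrite big_nat_cond (eq_bigr (fun=> 'X)); last first.
  by move=> i /andP[/andP[ri _] _]; rewrite ltnNge ri.
by rewrite -big_nat_cond prodr_const_nat.
Qed.

(** If [v (H + w^T w) = 0], multiplying by the right null vector [w^T] of [H]
leaves [(v . w) (w . w) = 0], so that [v] is orthogonal to [w] and in the left
kernel of [H].  This kernel is a line, hence spanned by its element [w], and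
[v = 0]. *)
Lemma simple_eigenvalue_unitmx d (H : 'M[F]_d) (w : 'rV[F]_d) :
  mup 0 (char_poly H) = 1%N -> w *m H = 0 -> H *m w^T = 0 ->
  w *m w^T != 0 -> H + w^T *m w \in unitmx.
Proof.
move=> mH wH Hw ww.
rewrite -row_free_unit -kermx_eq0; apply/rowV0P => v /sub_kermxP.
rewrite mulmxDr mulmxA => vA.
have vw : v *m w^T = 0.
  apply: (mulmx11_eq0 ww).
  have := congr1 (mulmx^~ w^T) vA.
  by rewrite mul0mx mulmxDl -!mulmxA Hw mulmx0 add0r !mulmxA.
have vH : v *m H = 0 by move: vA; rewrite vw mul0mx addr0.
have w0 : w != 0 by apply: contraNneq ww => ->; rewrite mul0mx.
have : (v <= w)%MS.
  have kw : (w <= kermx H)%MS by apply/sub_kermxP.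
  have rk : (\rank (kermx H) <= \rank w)%N.
    rewrite mxrank_ker rank_rV w0 (leq_trans (corank_le_mup_char_poly H))//.
    by rewrite mH.
  apply: (@submx_trans _ _ _ _ _ _ (kermx H)); first exact/sub_kermxP.
  by rewrite -(mxrank_leqif_sup kw) eqn_leq rk mxrankS.
move=> /sub_rVP[c vE]; move: vw; rewrite vE -scalemxAl => /eqP.
by rewrite scaler_eq0 (negPf ww) orbF => /eqP ->; rewrite scale0r.
Qed.

End Multiplicity.

(** * An implicit function theorem *)

HB.instance Definition _ (R : realType) (m n : nat) := Complete.on 'M[R]_(m, n).

Section SupNorm.
Context {R : realType}.

Lemma row_norm_le {d} (v : 'rV[R]_d) (c : R) : 0 <= c ->
  (`|v| <= c) <-> forall i, `|v 0 i| <= c.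
Proof.
move=> c0; rewrite /Num.norm/= mx_normrE; split=> [/bigmax_leP[_ H] i|H].
  exact: (H (0, i)).
by apply/bigmax_leP; split=> // -[i j] _ /=; rewrite ord1; exact: H.
Qed.

Lemma row_coord_le {d} (v : 'rV[R]_d) i : `|v 0 i| <= `|v|.
Proof. by have /(row_norm_le _ (normr_ge0 v)) := lexx `|v|. Qed.

Lemma mulmxr_bounded d p (B : 'M[R]_(d, p)) :
  exists2 K : R, 0 < K & forall v : 'rV[R]_d, `|v *m B| <= K * `|v|.
Proof.
exists (1 + \sum_i \sum_j `|B i j|).
  by rewrite ltr_wpDr// sumr_ge0// => i _; rewrite sumr_ge0.
move=> v; apply/row_norm_le.
  by rewrite mulr_ge0// addr_ge0// sumr_ge0// => i _; rewrite sumr_ge0.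
move=> j; rewrite mxE (le_trans (ler_norm_sum _ _ _))// mulrDl mul1r ler_wpDl//.
rewrite mulr_suml ler_sum// => i _; rewrite normrM mulrC ler_pM ?row_coord_le//.
by rewrite (bigD1 j)//= lerDl sumr_ge0.
Qed.

Lemma bounded_form_mulmx d p (B : 'M[R]_(d, p)) i :
  bounded_form (fun v : 'rV[R]_d => (v *m B) 0 i).
Proof.
split=> [c u v|]; first by rewrite mulmxDl -scalemxAl !mxE.
have [K K0 bK] := mulmxr_bounded B; exists K; first exact: ltW.
by move=> v; exact: le_trans (row_coord_le _ _) (bK v).
Qed.

End SupNorm.

Section ImplicitFunction.
Context {R : realType} {d : nat}.

(** The chord map [u |-> u - F (u, k) A^-1], where [A] is the derivative of [F]
in [u], has Lipschitz constant [1/2] near [a] for all small [k], because [F] is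
strictly differentiable jointly in [(u, k)].  It moves [a] by [O(k)]; so it maps
the closed ball of radius twice this displacement to itself, and the fixed point
in that ball is at distance [O(k)] from [a]. *)
Lemma implicit_function (F : 'rV[R]_d * R -> 'rV[R]_d) (a : 'rV[R]_d)
    (A : 'M[R]_d) (l : 'I_d -> 'rV[R]_d * R -> R) :
  (forall i, strict_derivative (fun z => F z 0 i) (a, 0) (l i)) ->
  (forall i v, l i (v, 0) = (v *m A) 0 i) ->
  A \in unitmx -> F (a, 0) = 0 ->
  exists (C : R) (u : R -> 'rV[R]_d),
    \forall k \near (0 : R), F (u k, k) = 0 /\ `|u k - a| <= C * `|k|.
Proof.
move=> sF lA uA F0.
have [K K0 bK] := mulmxr_bounded (invmx A).
pose e := (2 * K)^-1; have e0 : 0 < e by rewrite invr_gt0 mulr_gt0.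
have [Cl Cl0 bl] : exists2 Cl : R, 0 <= Cl & forall i z, `|l i z| <= Cl * `|z|.
  have /choice[C HC] i : exists C : R, 0 <= C /\ forall z, `|l i z| <= C * `|z|.
    by have [[_ [C C0 bC]] _] := sF i; exists C.
  exists (\sum_i C i); first by rewrite sumr_ge0// => i _; have [] := HC i.
  move=> i z; have [_ /(_ z) H] := HC i; rewrite (le_trans H)// ler_wpM2r//.
  by rewrite (bigD1 i)//= lerDl sumr_ge0// => j _; have [] := HC j.
have : \forall p \near ((a, 0 : R), (a, 0 : R)), forall i,
    `|F p.1 0 i - F p.2 0 i - l i (p.1 - p.2)| <= e * `|p.1 - p.2|.
  apply: (@filter_forall _ _ _ (nbhs ((a, 0 : R), (a, 0 : R)))) => i.
  by have [_] := sF i; exact.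
case=> -[Q1 Q2] /= [/nbhs_normP[r1 /= r10 Q1r] /nbhs_normP[r2 /= r20 Q2r]] Q12.
pose r := Num.min r1 r2; have r0 : 0 < r by rewrite lt_min r10.
have {Q1r Q2r Q12} near_lin z z' i :
    `|z - (a, 0 : R)| < r -> `|z' - (a, 0 : R)| < r ->
    `|F z 0 i - F z' 0 i - l i (z - z')| <= e * `|z - z'|.
  rewrite !lt_min distrC [in `|z' - _|]distrC => /andP[z1 _] /andP[_ z2].
  by apply: (Q12 (z, z')); split; [exact: Q1r|exact: Q2r].
have norm_pair (v : 'rV[R]_d) (k : R) : `|(v, k)| = Num.max `|v| `|k|.
  by rewrite prod_normE.
have norm_pair0 (v : 'rV[R]_d) : `|(v, 0 : R)| = `|v|.
  by rewrite norm_pair normr0 max_l.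
have norm0_pair (k : R) : `|(0 : 'rV[R]_d, k)| = `|k|.
  by rewrite norm_pair normr0 max_r.
have norm_at u (k : R) : `|(u, k) - (a, 0)| = Num.max `|u - a| `|k|.
  by rewrite prod_normE/= subr0.
have contr k u u' : `|k| < r -> `|u - a| < r -> `|u' - a| < r ->
    `|F (u, k) - F (u', k) - (u - u') *m A| <= e * `|u - u'|.
  move=> kr ur ur'; apply/row_norm_le; first by rewrite mulr_ge0// ltW.
  move=> i; rewrite mxE [X in _ + X]mxE -lA.
  have -> : (F (u, k) - F (u', k)) 0 i = F (u, k) 0 i - F (u', k) 0 i.
    by rewrite !mxE.
  have := @near_lin (u, k) (u', k) i; rewrite !norm_at !gt_max ur ur' kr.
  have -> : (u, k) - (u', k) = (u - u', 0) by congr (_, _); rewrite subrr.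
  by rewrite norm_pair0 => /(_ isT isT).
have Fa k : `|k| < r -> `|F (a, k)| <= (Cl + e) * `|k|.
  move=> kr; apply/row_norm_le; first by rewrite mulr_ge0// addr_ge0// ltW.
  move=> i; have := @near_lin (a, k) (a, 0) i; rewrite !norm_at F0.
  have -> : (a, k) - (a, 0) = (0, k) by congr (_, _); rewrite ?subrr ?subr0.
  rewrite subrr !normr0 !gt_max r0 kr mxE subr0 max_r//.
  move=> /(_ isT isT) H.
  rewrite -[F _ _ _](subrK (l i (0, k))) (le_trans (ler_normD _ _))//.
  rewrite mulrDl addrC lerD//.
  by rewrite (le_trans (bl _ _))// norm0_pair.
(* [C] leaves a factor [2] over the displacement of [a] under the chord map, to
   absorb the Lipschitz constant [1/2]. *)
pose C := 2 * K * (Cl + e).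
have C0 : 0 <= C.
  by apply: mulr_ge0; [rewrite ltW ?mulr_gt0|rewrite addr_ge0// ltW].
suff ex k : `|k| < r -> C * `|k| < r ->
    exists u, F (u, k) = 0 /\ `|u - a| <= C * `|k|.
  have /choice[u Hu] k : exists u, `|k| < r -> C * `|k| < r ->
      F (u, k) = 0 /\ `|u - a| <= C * `|k|.
    have [kr|] := boolP (`|k| < r); last by exists 0.
    have [Ckr|] := boolP (C * `|k| < r); last by exists 0.
    by have [u ?] := ex k kr Ckr; exists u.
  exists C, u.
  have C1 : 0 < C + 1 by lra.
  have h1 : \forall k \near (0 : R), `|k| < r by exact: (@nbhs0_lt R R).
  have h2 : \forall k \near (0 : R), `|k| < r / (C + 1).
    by apply: (@nbhs0_lt R R); rewrite divr_gt0.
  near=> k; apply: Hu; first by near: k.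
  have : `|k| < r / (C + 1) by near: k.
  rewrite ltr_pdivlMr//; have := normr_ge0 k; lra.
move=> kr Ckr.
pose U := closed_ball_ Num.norm a (C * `|k|).
pose T u := u - F (u, k) *m invmx A.
have UE u : U u = (`|u - a| <= C * `|k|) by rewrite /U /closed_ball_ /= distrC.
have lipT u u' : U u -> U u' -> `|T u - T u'| <= 2^-1 * `|u - u'|.
  rewrite !UE => uk uk'.
  have -> : T u - T u' = - ((F (u, k) - F (u', k) - (u - u') *m A) *m invmx A).
    rewrite mulmxBl mulmxK// mulmxBl /T !opprB addrCA; apply/eqP.
    rewrite -subr_eq0; apply/eqP/matrixP => i j; rewrite !mxE; ring.
  rewrite normrN (le_trans (bK _))//.
  rewrite (le_trans (ler_wpM2l (ltW K0) (contr _ _ _ kr _ _)))//.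
  - exact: le_lt_trans Ckr.
  - exact: le_lt_trans Ckr.
  - by rewrite mulrA ler_wpM2r// /e invfM mulrCA mulfV ?mulr1// gt_eqF.
have Ua : U a by rewrite UE subrr normr0 mulr_ge0.
have Ta : `|T a - a| <= 2^-1 * (C * `|k|).
  rewrite /T addrC addKr normrN (le_trans (bK _))//.
  rewrite (le_trans (ler_wpM2l (ltW K0) (Fa _ kr)))// /C.
  by rewrite !mulrA mulVf ?mul1r// pnatr_eq0.
have TU : {homo T : u / U u >-> U u}.
  move=> u Uu; rewrite UE -(subrK (T a) (T u)) -addrA.
  rewrite (le_trans (ler_normD _ _))//.
  have H1 := lipT u a Uu Ua; move: (Uu); rewrite UE => H2.
  by move: H1 H2 Ta; set n1 := `|_|; set n2 := `|_|; set n3 := `|_|; lra.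
have hq : 0 <= (2^-1 : R) by rewrite invr_ge0.
have [|||u Uu uE] := @banach_fixed_point R _ U (mkfun_fun TU).
- exists (NngNum hq); split => /=; first by lra.
  by move=> [u u'] /= [Uu Uu']; exact: lipT.
- exact: closed_closed_ball_.
- by exists a.
exists u; split; last by rewrite -UE.
move: uE; rewrite /= /T => /eqP.
rewrite -subr_eq0 opprB addrCA subrr addr0 => /eqP/(congr1 (mulmx^~ A)).
by rewrite mulmxKV// mul0mx.
Unshelve. all: by end_near. Qed.

End ImplicitFunction.

(** * Rotations *)

Section MatrixExponential.
Context {R : realType} {d : nat}.

(** The even and odd powers of [theta J] are [theta^k] times [1] and [J] up to
sign, so the exponential series splits into those of [cos] and [sin]. *)
Lemma expmx_complex_structure (J : 'M[R]_d) (theta : R) : J *m J = - 1%:M ->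
  expmx (theta *: J) = cos theta *: 1%:M + sin theta *: J.
Proof.
move=> JJ.
have powS k : J ^+ k.+1 = J *m J ^+ k by exact: exprS.
have powZ k : (theta *: J) ^+ k = theta ^+ k *: J ^+ k.
  elim: k => [|k ih]; first by rewrite !expr0 scale1r.
  have -> : (theta *: J) ^+ k.+1 = (theta *: J) *m (theta *: J) ^+ k.
    by exact: exprS.
  by rewrite ih powS -scalemxAl -scalemxAr scalerA -exprS.
have pow2 k : J ^+ k.*2 = (-1) ^+ k *: 1%:M.
  elim: k => [|k ih]; first by rewrite !expr0 scale1r.
  rewrite doubleS !powS ih -!scalemxAr mulmx1 JJ scalerN -scaleNr.
  by rewrite exprS mulN1r.
have pow k : J ^+ k = ((~~ odd k)%:R * (-1) ^+ k./2) *: 1%:M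
    + ((odd k)%:R * (-1) ^+ k.-1./2) *: J.
  rewrite -{1}(odd_double_half k); have [ok|ek] := boolP (odd k) => /=.
    rewrite mul0r scale0r add0r mul1r add1n powS pow2 -scalemxAr mulmx1.
    by case: k ok => //= k ok; rewrite uphalf_half (negPf ok).
  by rewrite mul0r scale0r addr0 mul1r add0n pow2.
apply: cvg_lim => //.
have -> : series (fun k : nat => (k`!%:R)^-1 *: (theta *: J) ^+ k) =
  (fun n => series (cos_coeff theta) n *: 1%:M
          + series (sin_coeff theta) n *: J).
  apply/funext => n; rewrite /series /= !scaler_suml -big_split /=.
  apply: eq_bigr => k _.
  rewrite powZ pow !scalerDr !scalerA /cos_coeff /sin_coeff /=.
  by rewrite -exprnP; congr (_ *: _ + _ *: _); ring.
apply: cvgD; apply: cvgZ; try exact: cvg_cst.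
- by rewrite cos.unlock; exact: is_cvg_series_cos_coeff.
- by rewrite sin.unlock; exact: is_cvg_series_sin_coeff.
Qed.

End MatrixExponential.

Section Rotation.
Context {R : realType} {n : nat}.
Implicit Types (u v : config R n) (p q : 'rV[R]_2).

(** A rotation when [c ^+ 2 + s ^+ 2 = 1].  Leaving [c] and [s] free covers both
the trigonometric and the rational parametrization of the circle. *)
Definition rot2 (c s : R) p : 'rV[R]_2 := c *: p + s *: mxapp J2 p.

Lemma ord2P (i : 'I_2) : i = 0 \/ i = 1.
Proof. by case: i => -[|[|//]] i2; [left|right]; apply/val_inj. Qed.

Lemma mxapp_J2 p : mxapp J2 p = \row_i (if i == 0 then - p 0 1 else p 0 0).
Proof.
apply/rowP => i; rewrite /mxapp mxE big_ord_recl big_ord1.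
have -> : lift ord0 ord0 = 1 :> 'I_2 by apply/val_inj.
by case: (ord2P i) => ->; rewrite !mxE /=; ring.
Qed.

Lemma dot2E p q : dot p q = p 0 0 * q 0 0 + p 0 1 * q 0 1.
Proof.
rewrite /dot big_ord_recl big_ord1.
by have -> : lift ord0 ord0 = 1 :> 'I_2 by apply/val_inj.
Qed.

Lemma sqr_enorm d (p : 'rV[R]_d) : enorm p ^+ 2 = dot p p.
Proof. by rewrite sqr_sqrtr// sumr_ge0// => i _; rewrite -expr2 sqr_ge0. Qed.

Lemma dot_eq0 p : (dot p p == 0) = (p == 0).
Proof.
apply/eqP/eqP => [|->]; last by rewrite dot2E !mxE mul0r addr0.
rewrite dot2E -!expr2 => /eqP; rewrite paddr_eq0 ?sqr_ge0// !sqrf_eq0.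
case/andP => /eqP p0 /eqP p1; apply/rowP => i; rewrite mxE.
by case: (ord2P i) => ->.
Qed.

Lemma dot_gt0 (p : 'rV[R]_2) : (0 < dot p p) = (p != 0).
Proof.
by rewrite lt_neqAle eq_sym dot_eq0 -sqr_enorm sqr_ge0 andbT.
Qed.

Lemma dot_rot2 c s p q : c ^+ 2 + s ^+ 2 = 1 ->
  dot (rot2 c s p) (rot2 c s q) = dot p q.
Proof.
move=> cs; rewrite !dot2E /rot2 !mxapp_J2 !mxE /=.
by rewrite -[RHS]mul1r -cs; ring.
Qed.

Lemma enorm_rot2 c s p : c ^+ 2 + s ^+ 2 = 1 -> enorm (rot2 c s p) = enorm p.
Proof. by move=> cs; rewrite /enorm dot_rot2. Qed.

Lemma rot2B c s p q : rot2 c s p - rot2 c s q = rot2 c s (p - q).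
Proof.
apply/rowP => i; rewrite /rot2 !mxapp_J2 !mxE; case: ifP => _; ring.
Qed.

Definition rot (c s : R) u : config R n := c *: u + s *: mxapp calJ u.

Lemma body_calJ u j : body (mxapp calJ u) j = mxapp J2 (body u j).
Proof.
rewrite /mxapp /calJ tr_mxdiag -[u in u *m _]submxrowK mul_mxrow_mxdiag.
by rewrite /body mxrowK.
Qed.

Lemma bodyD u v j : body (u + v) j = body u j + body v j.
Proof. exact: submxrowD. Qed.

Lemma bodyZ (c : R) u j : body (c *: u) j = c *: body u j.
Proof. by apply/rowP => i; rewrite !mxE. Qed.

Lemma body_rot c s u j : body (rot c s u) j = rot2 c s (body u j).
Proof. by rewrite /rot bodyD !bodyZ body_calJ. Qed.

Lemma config_ext u v : (forall j, body u j = body v j) -> u = v.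
Proof. by move=> uv; rewrite -[u]submxrowK -[v]submxrowK; apply: eq_mxrow. Qed.

Lemma calJ_sqr : calJ *m calJ = - 1%:M :> 'M[R]_(\sum_(j < n) 2).
Proof.
have JJ u : mxapp calJ (mxapp calJ u) = - u.
  apply: config_ext => j; rewrite !body_calJ -scaleN1r bodyZ scaleN1r.
  apply/rowP => i; rewrite !mxapp_J2 !mxE /=.
  by case: (ord2P i) => ->.
apply: trmx_inj; rewrite trmx_mul; apply/row_matrixP => i.
rewrite !rowE mulmxA; have := JJ (delta_mx 0 i); rewrite /mxapp => ->.
by rewrite raddfN/= trmx1 mulmxN mulmx1.
Qed.

Lemma mxapp_expmx_calJ theta u :
  mxapp (expmx (theta *: calJ)) u = rot (cos theta) (sin theta) u.
Proof.
rewrite (expmx_complex_structure _ calJ_sqr) /rot /mxapp.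
by rewrite raddfD/= !linearZ/= trmx1 mulmxDr -!scalemxAr mulmx1.
Qed.

Lemma rotK c s u : c ^+ 2 + s ^+ 2 = 1 -> rot c s (rot c (- s) u) = u.
Proof.
move=> cs; apply: config_ext => j; rewrite !body_rot.
apply/rowP => i; rewrite /rot2 !mxapp_J2 !mxE /=.
by rewrite -[RHS]mul1r -cs; case: (ord2P i) => -> /=; ring.
Qed.

Lemma rotD c s u v : rot c s (u + v) = rot c s u + rot c s v.
Proof. by rewrite /rot /mxapp mulmxDl !scalerDr addrACA. Qed.

Lemma rotZ c s (h : R) u : rot c s (h *: u) = h *: rot c s u.
Proof. by rewrite /rot /mxapp -scalemxAl scalerDr !scalerA ![_ * h]mulrC. Qed.

Lemma rot_cayley (t : R) u :
  u + (2 * t / (1 + t ^+ 2)) *: (mxapp calJ u - t *: u) =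
  rot ((1 - t ^+ 2) / (1 + t ^+ 2)) (2 * t / (1 + t ^+ 2)) u.
Proof.
have t0 : 1 + t ^+ 2 != 0 by rewrite gt_eqF// ltr_wpDr// sqr_ge0.
rewrite /rot scalerBr scalerA addrCA addrC; congr (_ + _).
rewrite -[X in X - _]scale1r -scalerBl; congr (_ *: _); field; exact: t0.
Qed.

Lemma cayley_unit (t : R) :
  ((1 - t ^+ 2) / (1 + t ^+ 2)) ^+ 2 + (2 * t / (1 + t ^+ 2)) ^+ 2 = 1.
Proof.
have t0 : 1 + t ^+ 2 != 0 by rewrite gt_eqF// ltr_wpDr// sqr_ge0.
by field; exact: t0.
Qed.

Variable m : 'I_n -> R.

Section Invariance.
Variables c s : R.
Hypothesis cs : c ^+ 2 + s ^+ 2 = 1.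

Lemma radicand_rot2 p q k :
  radicand (rot2 c s p) (rot2 c s q) k = radicand p q k.
Proof. by rewrite /radicand !enorm_rot2// dot_rot2. Qed.

Lemma lagrangian_rot k u : lagrangian m k (rot c s u) = lagrangian m k u.
Proof.
rewrite /lagrangian; congr (_ * _ + _).
  by apply: eq_bigr => j _; rewrite !body_rot /conf_factor !enorm_rot2.
apply: eq_bigr => j _; apply: eq_bigr => i _; congr (_ * _).
by rewrite !body_rot /potential rot2B radicand_rot2 !enorm_rot2// dot_rot2.
Qed.

Lemma lagrangian_dom_rot k u :
  lagrangian_dom k u -> lagrangian_dom k (rot c s u).
Proof.
case=> cf c1 r0; split.
- move=> i j /cf; rewrite !body_rot -subr_eq0 -dot_eq0 => uij.
  by rewrite -subr_eq0 -dot_eq0 rot2B dot_rot2.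
- by move=> j; rewrite body_rot enorm_rot2.
- by move=> i j ij; rewrite !body_rot radicand_rot2 r0.
Qed.

End Invariance.

End Rotation.

(** * The Lagrangian as an elementary function of configuration and curvature *)

Section ElementaryLagrangian.
Context {R : realType} {n : nat} (m : 'I_n -> R).
Local Notation V := (config R n * R)%type.
Implicit Types (D : set V) (z : V) (u : config R n).

Lemma elementary_coord D (i : 'I_(\sum_(j < n) 2)) :
  elementary D (fun z => z.1 0 i).
Proof.
apply: elementary_form; split=> [c u v|]; first by rewrite !mxE.
exists 1 => // z; rewrite mul1r prod_normE le_max.
by rewrite (row_coord_le z.1 i).
Qed.

Lemma elementary_kappa D : elementary D (fun z => z.2).
Proof.
apply: elementary_form; split=> [c u v|] //.
by exists 1 => // z; rewrite mul1r prod_normE le_max lexx orbT.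
Qed.

Lemma elementary_dot D (p q : V -> 'rV[R]_2) :
  (forall i, elementary D (fun z => p z 0 i)) ->
  (forall i, elementary D (fun z => q z 0 i)) ->
  elementary D (fun z => dot (p z) (q z)).
Proof.
move=> Ep Eq; apply: elementary_sum => i _; exact: elementaryM.
Qed.

Lemma elementary_body D (j : 'I_n) (i : 'I_2) :
  elementary D (fun z => body z.1 j 0 i).
Proof. by apply: elementary_ext (elementary_coord _ _) => z; rewrite mxE. Qed.

Lemma elementary_bodyB D (j k : 'I_n) (i : 'I_2) :
  elementary D (fun z => (body z.1 j - body z.1 k) 0 i).
Proof.
apply: (@elementary_ext _ _ _ (fun z : V => body z.1 j 0 i + - body z.1 k 0 i)).
  by move=> z; rewrite !mxE.
by apply: elementaryD; last apply: elementaryN; exact: elementary_body.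
Qed.

Lemma elementary_radicand D (i j : 'I_n) :
  elementary D (fun z => radicand (body z.1 i) (body z.1 j) z.2).
Proof.
apply: elementary_ext => [z|]; first by rewrite /radicand !sqr_enorm expr2.
apply: elementaryD; last exact: elementary_cst.
apply: elementaryD; apply: elementaryM; try exact: elementary_kappa.
- by apply: elementaryM; apply: elementary_dot => ?; exact: elementary_body.
- by apply: elementaryM; exact: elementary_kappa.
- apply: elementaryM; first exact: elementary_cst.
  by apply: elementary_dot => ?; exact: elementary_body.
Qed.

Lemma elementary_conf D (j : 'I_n) :
  elementary D (fun z => 1 + z.2 * enorm (body z.1 j) ^+ 2).
Proof.
apply: elementary_ext => [z|]; first by rewrite sqr_enorm.
apply: elementaryD; first exact: elementary_cst.
apply: elementaryM; first exact: elementary_kappa.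
by apply: elementary_dot => ?; exact: elementary_body.
Qed.

(** The domains for the individual curvatures, glued into one subset of the
space of pairs, since regularity is needed jointly in both variables. *)
Definition smooth_dom : set V := [set z | lagrangian_dom z.2 z.1].

Lemma elementary_lagrangian :
  elementary smooth_dom (fun z => lagrangian m z.2 z.1).
Proof.
apply: elementaryD.
  apply: elementaryM; first exact: elementary_cst.
  apply: elementary_sum => j _; apply: elementaryM.
    apply: elementaryM; first exact: elementary_cst.
    apply: elementaryM; first exact: elementary_cst.
    apply: elementaryV.
      apply: elementary_ext => [z|]; first by rewrite expr2.
      by apply: elementaryM; exact: elementary_conf.
    by move=> z [_ z1 _]; rewrite expf_neq0.
  apply: elementary_ext => [z|]; first by rewrite sqr_enorm.
  by apply: elementary_dot => ?; exact: elementary_body.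
apply: elementary_sum => j _; apply: elementary_sum => k jk.
apply: elementaryM; first exact: elementary_cst.
have jk' : j != k by rewrite neq_ltn jk.
apply: elementaryM.
  apply: elementary_ext => [z|]; first by rewrite !sqr_enorm.
  apply: elementaryD.
    apply: elementaryM; last exact: elementary_kappa.
    apply: elementaryM; first exact: elementary_cst.
    by apply: elementary_dot => ?; exact: elementary_body.
  apply: elementaryM; apply: elementaryD; try exact: elementary_cst.
    apply: elementaryM; last exact: elementary_kappa.
    by apply: elementary_dot => ?; exact: elementary_body.
  apply: elementaryM; last exact: elementary_kappa.
  by apply: elementary_dot => ?; exact: elementary_body.
have dpos z : smooth_dom z ->
    0 < dot (body z.1 j - body z.1 k) (body z.1 j - body z.1 k).
  by case=> cf _ _; rewrite dot_gt0 subr_eq0 cf.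
have rpos z : smooth_dom z -> 0 < radicand (body z.1 j) (body z.1 k) z.2.
  by case=> _ _; apply.
apply: elementaryV.
  apply: elementaryM; last first.
    by apply: elementary_sqrt => //; exact: elementary_radicand.
  apply: elementaryM; first exact: elementary_cst.
  apply: elementary_sqrt => //.
  by apply: elementary_dot => ?; exact: elementary_bodyB.
move=> z Dz; rewrite !mulf_neq0 ?pnatr_eq0// gt_eqF// sqrtr_gt0.
- exact: dpos.
- exact: rpos.
Qed.

Lemma smooth_dom_nbhs z : smooth_dom z -> \forall y \near z, smooth_dom y.
Proof.
have ctu f : elementary setT f -> f y @[y --> z] --> f z.
  by move=> Ef; exact: elementary_continuous Ef _.
move=> [cf c1 r0].
have n1 : \forall y \near z, forall i j : 'I_n, i != j ->
    0 < dot (body y.1 i - body y.1 j) (body y.1 i - body y.1 j).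
  apply: (@filter_forall _ _ _ (nbhs z)) => i.
  apply: (@filter_forall _ _ _ (nbhs z)) => j.
  have [ij|ij] := eqVneq i j; first by apply: (@nearW _ (nbhs z)).
  have : \forall y \near z,
      0 < dot (body y.1 i - body y.1 j) (body y.1 i - body y.1 j).
    apply: (@cvgr_gt _ _ _ _ _ _ (ctu _ _)).
      by apply: elementary_dot => ?; exact: elementary_bodyB.
    by rewrite dot_gt0 subr_eq0 cf.
  by apply: (@filterS _ (nbhs z)) => y ?.
have n2 : \forall y \near z, forall j, 1 + y.2 * enorm (body y.1 j) ^+ 2 != 0.
  apply: (@filter_forall _ _ _ (nbhs z)) => j.
  exact: (@cvgr_neq0 _ _ _ _ _ _ _ (ctu _ (elementary_conf _ _)) (c1 j)).
have n3 : \forall y \near z, forall i j : 'I_n, i != j ->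
    0 < radicand (body y.1 i) (body y.1 j) y.2.
  apply: (@filter_forall _ _ _ (nbhs z)) => i.
  apply: (@filter_forall _ _ _ (nbhs z)) => j.
  have [ij|ij] := eqVneq i j; first by apply: (@nearW _ (nbhs z)).
  have : \forall y \near z, 0 < radicand (body y.1 i) (body y.1 j) y.2.
    apply: (@cvgr_gt _ _ _ _ _ _ (ctu _ (elementary_radicand _ _ _))).
    exact: r0.
  by apply: (@filterS _ (nbhs z)) => y ?.
near=> y; split.
- move=> i j ij; rewrite -subr_eq0 -dot_gt0.
  by move: i j ij; near: y.
- by near: y.
- by near: y.
Unshelve. all: by end_near. Qed.

End ElementaryLagrangian.

(** * Central configurations *)

Lemma dotDl (R : realType) d (p q r : 'rV[R]_d) :
  dot (p + q) r = dot p r + dot q r.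
Proof. by rewrite -big_split; apply: eq_bigr => i _; rewrite mxE mulrDl. Qed.

Lemma dotZl (R : realType) d (c : R) (p r : 'rV[R]_d) :
  dot (c *: p) r = c * dot p r.
Proof. by rewrite /dot mulr_sumr; apply: eq_bigr => i _; rewrite mxE mulrA. Qed.

Lemma dot_suml (R : realType) d (I : finType) (P : pred I)
    (F : I -> 'rV[R]_d) r :
  dot (\sum_(i | P i) F i) r = \sum_(i | P i) dot (F i) r.
Proof.
apply: (big_morph (fun p => dot p r)) => [p q|]; first exact: dotDl.
by rewrite /dot big1// => i _; rewrite mxE mul0r.
Qed.

Section Kepler.
Context {R : realType} {n : nat} (m : 'I_n -> R).
Implicit Types (u v a : config R n).

Lemma strict_derivative_dot (V : normedModType R) (b : V -> 'rV[R]_2) x :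
  (forall i, bounded_form (fun z => b z 0 i)) ->
  strict_derivative (fun z : V => dot (b z) (b z)) x
    (fun v : V => 2 * dot (b x) (b v)).
Proof.
move=> bb; apply: strict_derivative_eq; last first.
  apply: strict_derivative_sum => i _.
  by apply: strict_derivativeM; apply: bounded_form_strict; exact: bb.
move=> v /=; rewrite /dot mulr_sumr; apply: eq_bigr => i _; ring.
Qed.

Lemma bounded_form_body j i : bounded_form (fun u => body u j 0 i).
Proof.
split=> [c u v|]; first by rewrite !mxE.
by exists 1 => // u; rewrite mul1r mxE row_coord_le.
Qed.

Lemma bounded_form_bodyB j k i :
  bounded_form (fun u => (body u j - body u k) 0 i).
Proof.
have -> : (fun u => (body u j - body u k) 0 i) =
    (fun u => 1 * body u j 0 i + -1 * body u k 0 i).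
  by apply/funext => u; rewrite [LHS]mxE [X in _ + X]mxE mul1r mulN1r.
by apply: bounded_form_comb; exact: bounded_form_body.
Qed.

Lemma lagrangian0E u : lagrangian m 0 u =
  \sum_(j < n) 2 * m j * dot (body u j) (body u j) +
  \sum_(j < n) \sum_(k < n | (j < k)%N) m j * m k * 2^-1 *
    (Num.sqrt (dot (body u j - body u k) (body u j - body u k)))^-1.
Proof.
rewrite /lagrangian mulr_sumr; congr (_ + _).
  apply: eq_bigr => j _.
  by rewrite sqr_enorm /conf_factor mul0r addr0 expr1n divr1; field.
apply: eq_bigr => j _; apply: eq_bigr => k _.
rewrite /potential /radicand expr0n /= !mulr0 !add0r sqrtr1 mulr1 mulrNN.
by rewrite mulr1 mul1r invfM mulrA.
Qed.

Lemma strict_derivative_lagrangian0 u : collision_free u ->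
  strict_derivative (lagrangian m 0) u (fun v =>
    \sum_(j < n) 4 * m j * dot (body u j) (body v j) -
    2^-1 * \sum_(j < n) \sum_(k < n | (j < k)%N)
      m j * m k / enorm (body u j - body u k) ^+ 3 *
      dot (body u j - body u k) (body v j - body v k)).
Proof.
move=> cf; have -> := funext lagrangian0E.
apply: strict_derivative_eq; last first.
  apply: strict_derivativeD; apply: strict_derivative_sum => j _.
    apply: strict_derivativeZ; apply: strict_derivative_dot.
    exact: bounded_form_body.
  apply: strict_derivative_sum => k jk; apply: strict_derivativeZ.
  have d0 : 0 < dot (body u j - body u k) (body u j - body u k).
    by rewrite dot_gt0 subr_eq0 cf// neq_ltn jk.
  apply: (@strict_derivativeV _ _ (fun u => Num.sqrt _)).
    by rewrite gt_eqF// sqrtr_gt0.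
  apply: (@strict_derivative_sqrt _ _ (fun u => dot _ _)) => //.
  apply: (@strict_derivative_dot _ (fun u => body u j - body u k)) => i.
  exact: bounded_form_bodyB.
move=> v /=; congr (_ + _); first by apply: eq_bigr => j _; ring.
rewrite mulr_sumr -sumrN; apply: eq_bigr => j _.
rewrite mulr_sumr -sumrN; apply: eq_bigr => k jk.
have d0 : Num.sqrt (dot (body u j - body u k) (body u j - body u k)) != 0.
  by rewrite gt_eqF// sqrtr_gt0 dot_gt0 subr_eq0 cf// neq_ltn jk.
by rewrite -/(enorm (body u j - body u k)) in d0 *; field.
Qed.

Lemma sum_pairs (X : 'I_n -> 'I_n -> R) :
  \sum_(j < n) \sum_(k < n | k != j) X j k =
  \sum_(j < n) \sum_(k < n | (j < k)%N) (X j k + X k j).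
Proof.
under [RHS]eq_bigr do rewrite big_split.
rewrite big_split /= [X in _ = _ + X](exchange_big_dep xpredT)//= -big_split /=.
apply: eq_bigr => j _; rewrite (bigID (fun k : 'I_n => (j < k)%N)) /=.
congr (_ + _); apply: eq_bigl => k; rewrite -val_eqE /=; lia.
Qed.

(** Each central configuration equation, paired with [m j] times the [j]-th
component of the direction, cancels the [j]-th term of the derivative; the sum
over [j < k] has first to be unfolded into one over ordered pairs. *)
Lemma central_configuration_critical a : central_configuration m a ->
  strict_derivative (lagrangian m 0) a (fun=> 0).
Proof.
move=> [cf ca].
apply: strict_derivative_eq (strict_derivative_lagrangian0 cf) => v.
pose X j k := m j * m k / enorm (body a j - body a k) ^+ 3 *
  dot (body a j - body a k) (body v j).
have enC j k : enorm (body a k - body a j) = enorm (body a j - body a k).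
  by rewrite /enorm !dot2E !mxE; congr Num.sqrt; ring.
have -> : \sum_(j < n) \sum_(k < n | (j < k)%N)
      m j * m k / enorm (body a j - body a k) ^+ 3 *
      dot (body a j - body a k) (body v j - body v k) =
    \sum_j \sum_(k | k != j) X j k.
  rewrite sum_pairs; apply: eq_bigr => j _; apply: eq_bigr => k _.
  by rewrite /X (enC j k) !dot2E !mxE; ring.
rewrite mulr_sumr -sumrB big1// => j _.
have := congr1 (fun p => m j * dot p (body v j)) (ca j).
rewrite !dotZl dot_suml => E.
apply/eqP; rewrite subr_eq0; apply/eqP.
transitivity (m j * (4 * dot (body a j) (body v j))); first by ring.
rewrite E mulrCA; congr (_ * _); rewrite mulr_sumr; apply: eq_bigr => k _.
by rewrite dotZl /X; ring.
Qed.

End Kepler.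

(** * Rotational symmetry of the critical points *)

Section Equivariance.
Context {R : realType} {n : nat} (m : 'I_n -> R).
Implicit Types (u v a : config R n) (k : R).

Lemma derive_rot (f : config R n -> R) c s u v : c ^+ 2 + s ^+ 2 = 1 ->
  (forall z, f (rot c s z) = f z) ->
  'D_v f (rot c s u) = 'D_(rot c (- s) v) f u.
Proof.
move=> cs fi; rewrite /derive.
suff -> :
    (fun h => h^-1 *: ((f \o shift (rot c s u)) (h *: v) - f (rot c s u))) =
    (fun h => h^-1 *: ((f \o shift u) (h *: rot c (- s) v) - f u)) by [].
apply/funext => h /=; rewrite fi; congr (_ *: (_ - _)).
by rewrite -[RHS]fi rotD rotZ rotK.
Qed.

Lemma critical_points_rot c s u k : c ^+ 2 + s ^+ 2 = 1 ->
  critical_points m k u -> critical_points m k (rot c s u).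
Proof.
move=> cs [Du g0]; split; first exact: lagrangian_dom_rot.
have [dL [_ sL]] := elementary_derivative (elementary_lagrangian m).
have /= sl := strict_derivative_slice (sL (u, k) Du).
have := gradientE sl; rewrite g0 => l0.
apply/rowP => i; rewrite !mxE derive_rot//; last first.
  by move=> z; exact: lagrangian_rot.
rewrite (strict_derivative_derive _ sl) (bounded_form_row _ sl.1) big1// => j _.
by have := congr1 (fun v => v 0 j) l0; rewrite !mxE => <-; rewrite mulr0.
Qed.

(** The infinitesimal form of the invariance of the Lagrangian: [J u] is tangent
to the orbit of [u]. *)
Lemma gradient_orth u k : lagrangian_dom k u ->
  gradient (lagrangian m k) u *m (mxapp calJ u)^T = 0.
Proof.
move=> Du.
have [dL [_ sL]] := elementary_derivative (elementary_lagrangian m).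
have /= sl := strict_derivative_slice (sL (u, k) Du).
rewrite (gradientE sl); apply/rowP => i; rewrite ord1 [RHS]mxE.
have := strict_derivative_invariant (w := mxapp calJ u) sl.
rewrite (bounded_form_row _ sl.1) => H; rewrite -[RHS]H.
  by rewrite mxE; apply: eq_bigr => j _; rewrite !mxE mulrC.
by move=> t; rewrite rot_cayley lagrangian_rot// cayley_unit.
Qed.

End Equivariance.

Theorem theorem6 (R : realType) (n : nat) (m : 'I_n -> R) (a : config R n)
    (hn : (2 <= n)%N) (hm : forall j : 'I_n, 0 < m j)
    (ha : central_configuration m a) (hnd : nondegenerate_config m a) :
  exists kappa0 : R, 0 < kappa0 /\
  exists u : R -> config R n,
    (forall kappa : R, `|kappa| < kappa0 ->
       SO2_orbit (u kappa) `<=` critical_points m kappa) /\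
    (fun kappa : R => u kappa - a) =O_ (0 : R) (fun kappa : R => kappa).
Proof.
have [dL [edL sL]] := elementary_derivative (elementary_lagrangian m).
pose D := smooth_dom (R := R) (n := n).
pose G (z : config R n * R) : config R n := \row_i dL (delta_mx 0 i, 0) z.
have GE z : D z -> gradient (lagrangian m z.2) z.1 = G z.
  case: z => u k Du; have /= sl := strict_derivative_slice (sL (u, k) Du).
  by rewrite (gradientE sl).
have Da : D (a, 0).
  split=> /= [|j|i j _]; first exact: ha.1.
  - by rewrite mul0r addr0 oner_neq0.
  - by rewrite /radicand expr0n /= !mulr0 !add0r.
have Ga : G (a, 0) = 0.
  rewrite -GE//= (gradientE (central_configuration_critical ha)).
  by apply/rowP => i; rewrite !mxE.
have ca : critical_points m 0 a by split=> //; rewrite (GE (a, 0)).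
have /choice[l sG] i : exists l, strict_derivative (fun z => G z 0 i) (a, 0) l.
  have [dg [_ sg]] := elementary_derivative (edL (delta_mx 0 i, 0)).
  exists (dg^~ (a, 0)); have -> : (fun z => G z 0 i) = dL (delta_mx 0 i, 0).
    by apply/funext => z; rewrite mxE.
  exact: sg.
pose H := hessian (lagrangian m 0) a.
pose w := mxapp calJ a.
have [mH w0 Hw] : [/\ mup 0 (char_poly H) = 1%N, w != 0 & mxapp H w = 0] := hnd.
have sG0 i := strict_derivative_slice (sG i).
(* In the row convention the derivative of the gradient is [v |-> v H]. *)
have lH i v : l i (v, 0) = (v *m H) 0 i.
  rewrite (bounded_form_row _ (sG0 i).1) mxE; apply: eq_bigr => j _.
  congr (_ * _).
  rewrite -(strict_derivative_derive _ (sG0 i)) mxE; apply: near_eq_derive.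
  have ca0 : ((fun u : config R n => (u, 0 : R)) u) @[u --> a] --> (a, 0 : R).
    by apply: (@cvg_pair _ _ _ (nbhs a) (nbhs a) (nbhs (0 : R)));
      [exact: cvg_id|exact: cvg_cst].
  have := ca0 _ (smooth_dom_nbhs Da).
  by apply: (@filterS _ (nbhs a)) => u Du; rewrite -(GE (u, 0) Du) mxE.
(* The whole orbit of [a] is critical, so the gradient is constant along it. *)
have wH : w *m H = 0.
  apply/rowP => i; rewrite -lH mxE.
  apply: (strict_derivative_invariant (sG0 i)) => t; rewrite rot_cayley Ga.
  have [Dr gr] := critical_points_rot (cayley_unit t) ca.
  by rewrite -(GE (_, 0) Dr)/= gr.
have Hw' : H *m w^T = 0.
  by apply: trmx_inj; rewrite trmx_mul trmxK trmx0.
have ww := mulmx_tr_neq0 w0.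
have uA := simple_eigenvalue_unitmx mH wH Hw' ww.
pose F z : config R n := G z + (z.1 - a) *m w^T *m w.
pose b i (z : config R n * R) := (z.1 *m (w^T *m w)) 0 i.
have bb i : bounded_form (b i).
  exact: bounded_form_fst (bounded_form_mulmx (w^T *m w) i).
have sF i : strict_derivative (fun z => F z 0 i) (a, 0)
    (fun v => l i v + b i v).
  have -> : (fun z => F z 0 i) = (fun z => G z 0 i + (b i z + - b i (a, 0))).
    apply/funext => z; rewrite /F -mulmxA mulmxBl mxE; congr (_ + _).
    by rewrite mxE; congr (_ + _); rewrite mxE.
  apply: strict_derivativeD => //; apply: strict_derivative_eq; last first.
    by apply: strict_derivativeD;
      [exact: bounded_form_strict|exact: strict_derivative_cst].
  by move=> v; rewrite addr0.
have [||C [u Hu]] := implicit_function sF _ uA.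
- by move=> i v; rewrite lH mulmxDr [RHS]mxE.
- by rewrite /F Ga subrr !mul0mx addr0.
have cu : u k @[k --> (0 : R)] --> a.
  apply/cvgrPdist_le => e e0.
  have C1 : 0 < `|C| + 1 by rewrite ltr_wpDl.
  have ke : \forall k \near (0 : R), `|k| <= e / (`|C| + 1).
    by apply: (@nbhs0_le R R); rewrite divr_gt0.
  near=> k; rewrite distrC.
  have [_ /le_trans -> //] : F (u k, k) = 0 /\ `|u k - a| <= C * `|k|.
    by near: k.
  have : `|k| <= e / (`|C| + 1) by near: k.
  rewrite ler_pdivlMr// mulrC; apply: le_trans; rewrite ler_wpM2r//.
  by rewrite (le_trans (ler_norm _))// lerDl.
have cuk : (u k, k) @[k --> (0 : R)] --> (a, 0 : R).
  by apply: (@cvg_pair _ _ _ (nbhs (0 : R)) (nbhs a) (nbhs (0 : R))) => //;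
    exact: cvg_id.
have near_crit : \forall k \near (0 : R), critical_points m k (u k).
  have nD := cuk _ (smooth_dom_nbhs Da).
  have nw : \forall k \near (0 : R), w *m (mxapp calJ (u k))^T != 0.
    pose g (v : config R n) := (v *m (calJ^T *m w^T)) 0 0.
    have gE (v : config R n) : g v = (w *m (mxapp calJ v)^T) 0 0.
      transitivity ((w *m (mxapp calJ v)^T)^T 0 0); last by rewrite mxE.
      by rewrite (trmx_mul w) trmxK /g mulmxA.
    have cg := strict_derivative_continuous
      (bounded_form_strict a (bounded_form_mulmx (calJ^T *m w^T) 0)).
    have ga : g a != 0.
      rewrite gE; apply: contraNneq ww => ww0.
      by rewrite [w *m w^T]mx11_scalar ww0 raddf0.
    have ng : \forall k \near (0 : R), g (u k) != 0.
      apply: (@cvgr_neq0 _ _ _ (nbhs (0 : R)) _ (fun k => g (u k)) (g a)) => //.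
      exact: (cvg_comp _ _ cu cg).
    apply: filterS ng => k; apply: contraNneq => wk0.
    by rewrite gE wk0 mxE.
  near=> k.
  have Du : D (u k, k) by near: k.
  have [Fk _] : F (u k, k) = 0 /\ `|u k - a| <= C * `|k| by near: k.
  have wk : w *m (mxapp calJ (u k))^T != 0 by near: k.
  split=> //.
  have := congr1 (mulmx^~ (mxapp calJ (u k))^T) Fk.
  rewrite mul0mx mulmxDl -(GE _ Du) gradient_orth// add0r -mulmxA.
  move: Fk; rewrite /F /=.
  set x := (u k - a) *m w^T => Fk xw.
  have x0 : x = 0 by exact: (mulmx11_eq0 wk).
  by move: Fk; rewrite x0 mul0mx addr0 -(GE _ Du).
have /nbhs_normP[k0 /= k00 Hk0] := near_crit.
exists k0; split=> //; exists u; split.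
- move=> k kk0 _ [theta _ <-]; rewrite mxapp_expmx_calJ.
  apply: critical_points_rot; first exact: cos2Dsin2.
  by apply: Hk0 => /=; rewrite sub0r normrN.
- apply/eqO_exP; exists (`|C| + 1); first by rewrite ltr_wpDl.
  apply: filterS Hu => k [_ Huk].
  rewrite (le_trans Huk)// ler_wpM2r//.
  by rewrite (le_trans (ler_norm _))// lerDl.
Unshelve. all: by end_near. Qed.
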